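(* Let $\mathcal{C}\subseteq\mathbb{R}^n$ be a compact convex set, let $f\colon\mathcal{C}\to\mathbb{R}$ be convex and differentiable in an open set containing $\mathcal{C}$, let $\eta_t=\frac{\ell}{t+\ell}$ for some integer $\ell\ge 1$ and all $t\in\mathbb{N}$, and suppose that $(\mathcal{C},f)$ satisfies the strong $(M,0)$-growth and the weak $(M,r)$-growth properties for some $M>0$ and $r\in[0,1)$. Let $\epsilon\in(0,\ell)$. Let $(x_t)_{t\in\mathbb{N}}$ be the iterates of the Frank-Wolfe algorithm with step-sizes $\eta_t$. Then, for all integers $t\ge 1$, $$\mathrm{subopt}_t\le\exp(\epsilon\ell)\max\left\{\eta_{t-1}^{\ell-\epsilon}\frac{M}{2},\ \eta_{t-1}^{\min\{\ell-\epsilon,\frac{1}{1-r},2\}}\left(\left(\frac{\ell M}{2\epsilon}\right)^{\frac{1}{1-r}}+\frac{M}{2}\right)\right\}=\mathcal{O}\left(t^{-\ell+\epsilon}+t^{-\frac{1}{1-r}}+t^{-2}\right).$$ Furthermore, either there exists a subsequence of indices $(t_i)_{i\in\mathbb{N}}$ for which $$\mathrm{subopt}_{t_i}\le\left(\frac{\eta_{t_i}\ell M}{2\epsilon}\right)^{\frac{1}{1-r}}\quad\text{for all } i\in\mathbb{N},$$ or there exists an integer $R\ge 1$ such that for all integers $t\ge R+1$, $$\mathrm{subopt}_t\le\mathrm{subopt}_R\left(\frac{\eta_{t-1}}{\eta_{R-1}}\right)^{\ell-\epsilon}\exp\left(\frac{\epsilon\ell}{R}\right).$$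
   Context: $\mathbb{N}=\{0,1,2,\ldots\}$. Frank-Wolfe algorithm for $\min_{x\in\mathcal{C}}f(x)$ with step-sizes $\eta_t\in[0,1]$: given any $x_0\in\mathcal{C}$, for $t=0,1,2,\ldots$ choose any $v_t\in\operatorname{argmin}_{v\in\mathcal{C}}\langle\nabla f(x_t),v-x_t\rangle$ and set $x_{t+1}=x_t+\eta_t(v_t-x_t)$. For $x,y\in\mathcal{C}$: $D_f(y,x)=f(y)-f(x)-\langle\nabla f(x),y-x\rangle$, $\mathrm{subopt}(x)=f(x)-\min_{y\in\mathcal{C}}f(y)$, and $\mathrm{gap}(x)=\max_{v\in\mathcal{C}}\langle\nabla f(x),x-v\rangle$. For the iterates, $\mathrm{subopt}_t=\mathrm{subopt}(x_t)$. Strong $(M,0)$-growth property: for all $x\in\mathcal{C}$ and all $v\in\operatorname{argmin}_{y\in\mathcal{C}}\langle\nabla f(x),y-x\rangle$, $D_f(x+\eta(v-x),x)\le\frac{M\eta^2}{2}$ for all $\eta\in[0,1]$. Weak $(M,r)$-growth property: for all $x\in\mathcal{C}$ and all $v\in\operatorname{argmin}_{y\in\mathcal{C}}\langle\nabla f(x),y-x\rangle$, $D_f(x+\eta(v-x),x)\cdot\mathrm{subopt}(x)^{1-r}\le\frac{M\eta^2}{2}\,\mathrm{gap}(x)$ for all $\eta\in[0,1]$. A subsequence of indices means a strictly increasing sequence in $\mathbb{N}$. *)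

(* Defs.v *)
From HB Require Import structures.
From mathcomp Require Import all_boot all_order all_algebra.
From mathcomp Require Import all_classical all_reals all_analysis.

Set Implicit Arguments.
Unset Strict Implicit.
Unset Printing Implicit Defensive.

Import Order.TTheory GRing.Theory Num.Theory.
Import numFieldNormedType.Exports.

Local Open Scope classical_set_scope.
Local Open Scope ring_scope.

(* A function on C is represented by a total function on R^n; its values
   outside the open set on which it is differentiable play no role. *)

Definition dotp (R : realType) (n : nat) (u v : 'rV[R]_n) : R :=
  \sum_(i < n) u 0 i * v 0 i.

Definition grad (R : realType) (n : nat) (f : 'rV[R]_n -> R) (x : 'rV[R]_n) :
    'rV[R]_n :=
  \row_(i < n) 'D_(delta_mx 0 i) f x.

Definition bregman (R : realType) (n : nat) (f : 'rV[R]_n -> R)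
    (y x : 'rV[R]_n) : R :=
  f y - f x - dotp (grad f x) (y - x).

(* The infimum and the supremum below are attained, hence are a minimum and a
   maximum, when C is compact and nonempty and f is continuous on C. *)
Definition subopt (R : realType) (n : nat) (C : set 'rV[R]_n)
    (f : 'rV[R]_n -> R) (x : 'rV[R]_n) : R :=
  f x - inf [set f y | y in C].

Definition fw_gap (R : realType) (n : nat) (C : set 'rV[R]_n)
    (f : 'rV[R]_n -> R) (x : 'rV[R]_n) : R :=
  sup [set dotp (grad f x) (x - v) | v in C].

(* v is in the argmin of <grad f x, v - x> over C *)
Definition fw_argmin (R : realType) (n : nat) (C : set 'rV[R]_n)
    (f : 'rV[R]_n -> R) (x v : 'rV[R]_n) : Prop :=
  C v /\ forall w, C w -> dotp (grad f x) (v - x) <= dotp (grad f x) (w - x).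

Definition strong_growth0 (R : realType) (n : nat) (C : set 'rV[R]_n)
    (f : 'rV[R]_n -> R) (M : R) : Prop :=
  forall x v : 'rV[R]_n, C x -> fw_argmin C f x v ->
  forall eta : R, 0 <= eta <= 1 ->
  bregman f (x + eta *: (v - x)) x <= M * eta ^+ 2 / 2.

Definition weak_growth (R : realType) (n : nat) (C : set 'rV[R]_n)
    (f : 'rV[R]_n -> R) (M r : R) : Prop :=
  forall x v : 'rV[R]_n, C x -> fw_argmin C f x v ->
  forall eta : R, 0 <= eta <= 1 ->
  bregman f (x + eta *: (v - x)) x * subopt C f x `^ (1 - r)
    <= M * eta ^+ 2 / 2 * fw_gap C f x.

Definition frank_wolfe (R : realType) (n : nat) (C : set 'rV[R]_n)
    (f : 'rV[R]_n -> R) (eta : nat -> R) (x : nat -> 'rV[R]_n) : Prop :=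
  C (x 0%N) /\
  forall t, exists2 v, fw_argmin C f (x t) v &
    x t.+1 = x t + eta t *: (v - x t).

Definition step (R : realType) (l t : nat) : R := l%:R / (t + l)%:R.

Definition fw_bound (R : realType) (l : nat) (M r eps : R) (t : nat) : R :=
  expR (eps * l%:R) *
  Num.max
    (step R l t.-1 `^ (l%:R - eps) * (M / 2))
    (step R l t.-1 `^ Num.min (l%:R - eps) (Num.min (1 - r)^-1 2) *
       ((l%:R * M / (2 * eps)) `^ (1 - r)^-1 + M / 2)).

(* Main.v *)
(** Write [h t] for the suboptimality and [eta t = l / (t + l)].  Convexity gives
    [h <= gap], and the weak growth property shows that whenever [h t] exceeds
    the threshold [(eta t * l * M / (2 eps)) ^ (1 / (1 - r))], the quadratic term
    eats at most an [eps / l] fraction of the progress, so that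
    [h (t + 1) <= (1 - eta t (1 - eps / l)) h t].  This factor is at most
    [(eta t / eta (t - 1)) ^ (l - eps)] up to a telescoping exponential.  When
    [h t] is below the threshold, strong growth bounds [h (t + 1)] directly.
    Either the second case occurs infinitely often, or the contraction holds
    from some index on; the global bound is an induction over both cases, in
    which the accumulated exponential is part of the invariant. *)

Require Import Defs.
From HB Require Import structures.
From mathcomp Require Import all_boot all_order all_algebra.
From mathcomp Require Import all_classical all_reals all_analysis.
From mathcomp Require Import ring lra.
Import Order.TTheory GRing.Theory Num.Theory.
Import numFieldNormedType.Exports.
Local Open Scope classical_set_scope.
Local Open Scope ring_scope.

(** * Subsequences and Bernoulli's inequality *)

Lemma ltn_subsequence (P : nat -> Prop) :
  (forall N, exists2 t, (N <= t)%N & P t) ->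
  exists tau : nat -> nat,
    {homo tau : i j / (i < j)%N} /\ forall i, P (tau i).
Proof.
move=> infP.
have /choice[F /all_and2[leF PF]] : forall N, exists t, (N <= t)%N /\ P t.
  by move=> N; have [t] := infP N; exists t.
(* Each search starts one past the index found before, which makes the sequence strictly
   increasing. *)
exists (fun i => F (iteri i (fun _ k => (F k).+1) 0%N)); split => //.
by apply: homo_ltn; [exact: ltn_trans | move=> i; exact: leF].
Qed.

Lemma bernoulli_subr (R : realDomainType) (u : R) (k : nat) :
  0 <= u <= 1 -> 1 - k%:R * u <= (1 - u) ^+ k.
Proof.
move=> /andP[u0 u1]; elim: k => [|k IHk]; first by rewrite mul0r subr0 expr0.
rewrite exprS; apply: le_trans (ler_wpM2l _ IHk); last by rewrite subr_ge0.
rewrite -natr1 -subr_ge0.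
have -> : (1 - u) * (1 - k%:R * u) - (1 - (k%:R + 1) * u) = k%:R * u ^+ 2 by ring.
by rewrite mulr_ge0 ?ler0n ?sqr_ge0.
Qed.

(** * Inner product, gradient and the first-order convexity inequality *)

Lemma dotpN (R : realType) n (g u : 'rV[R]_n) : dotp g (- u) = - dotp g u.
Proof. by rewrite /dotp -sumrN; apply: eq_bigr => i _; rewrite mxE mulrN. Qed.

Lemma dotpZ (R : realType) n (g u : 'rV[R]_n) a : dotp g (a *: u) = a * dotp g u.
Proof.
by rewrite /dotp mulr_sumr; apply: eq_bigr => i _; rewrite mxE mulrCA.
Qed.

Lemma derive_dotp_grad (R : realType) n (f : 'rV[R]_n -> R) (x u : 'rV[R]_n) :
  differentiable f x -> 'D_u f x = dotp (grad f x) u.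
Proof.
move=> df; rewrite deriveE// {1}(row_sum_delta u) linear_sum.
apply: eq_bigr => i _; rewrite linearZ /= mxE deriveE//.
by rewrite [LHS]mulrC.
Qed.

Lemma convex_gradient_ineq (R : realType) n (C : set 'rV[R]_n)
    (f : 'rV[R]_n -> R) (x y : 'rV[R]_n) :
  @convex_function R 'rV[R]_n C f -> differentiable f x -> C x -> C y ->
  dotp (grad f x) (y - x) <= f y - f x.
Proof.
move=> cvxf df Cx Cy; rewrite -derive_dotp_grad//.
have dfx : derivable f x (y - x) by exact: diff_derivable.
(* Convexity controls the difference quotient only for [0 < h <= 1], where the point stays on the
   segment from [x] to [y]; hence the limit from the right. *)
rewrite /derive cvg_at_rightE//; apply: limr_le.
  rewrite -(cvg_at_rightE (fun h : R => h^-1 *: ((f \o shift x) _ - f x)))//.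
  apply: cvg_trans dfx; apply: cvg_app.
  move=> A [e e0 Ae]; exists e => // z ze z0; apply: Ae => //.
  exact/lt0r_neq0.
near=> h.
have h0 : 0 < h by near: h; exact: nbhs_right_gt.
have h1 : h <= 1 by near: h; exact: nbhs_right_le.
have h01 : 0 <= h <= 1 by rewrite ltW.
pose t : {i01 R} := Itv01 (ltW h0) h1.
have := cvxf t y x (mem_set Cy) (mem_set Cx).
rewrite convRE [X in f X <= _](_ : _ = h *: (y - x) + x); last first.
  by rewrite /conv /= /unstable.onem scalerBl scale1r scalerBr addrA addrAC.
rewrite /= /unstable.onem => H.
rewrite -[leLHS]/(h^-1 * (f (h *: (y - x) + x) - f x)) mulrC ler_pdivrMr//.
by lra.
Unshelve. all: by end_near. Qed.

(** * A single Frank-Wolfe step *)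

Section FrankWolfeStep.
Context {R : realType} {n : nat} {C : set 'rV[R]_n} {f : 'rV[R]_n -> R}.
Context {x v : 'rV[R]_n}.
Hypothesis argv : fw_argmin C f x v.

Lemma fw_gapE : fw_gap C f x = dotp (grad f x) (x - v).
Proof.
have [Cv vmin] := argv.
have ub : ubound [set dotp (grad f x) (x - w) | w in C]
    (dotp (grad f x) (x - v)).
  by move=> _ [w Cw <-]; rewrite -lerN2 -!dotpN !opprB; exact: vmin.
apply/eqP; rewrite eq_le; apply/andP; split.
  by apply: ge_sup => //; exists (dotp (grad f x) (x - v)), v.
by apply: ub_le_sup; [exists (dotp (grad f x) (x - v)) | exists v].
Qed.

(** An exact identity, so that each growth property, being a bound on [bregman], becomes a bound on
    the next suboptimality. *)
Lemma subopt_step eta : subopt C f (x + eta *: (v - x)) =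
  subopt C f x - eta * fw_gap C f x + bregman f (x + eta *: (v - x)) x.
Proof.
rewrite fw_gapE /subopt /bregman (addrC x) addrK dotpZ.
by rewrite -(opprB v x) dotpN; ring.
Qed.

Lemma subopt_le_fw_gap : C x ->
  @convex_function R 'rV[R]_n C f -> differentiable f x ->
  0 <= subopt C f x <= fw_gap C f x.
Proof.
move=> Cx cvxf df.
(* This lower bound also shows that the image of [C] is bounded below, so [inf] is a true
   infimum. *)
have lb : lbound [set f y | y in C] (f x - fw_gap C f x).
  move=> _ [y Cy <-].
  have := convex_gradient_ineq _ _ _ _ _ _ cvxf df Cx Cy.
  have [_ /(_ y Cy)] := argv.
  by rewrite fw_gapE -(opprB v x) dotpN; lra.
rewrite /subopt; apply/andP; split.
  rewrite subr_ge0; apply: ge_inf; last by exists x.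
  by exists (f x - fw_gap C f x).
suff : f x - fw_gap C f x <= inf [set f y | y in C] by lra.
by apply: lb_le_inf => //; exists (f x), x.
Qed.

End FrankWolfeStep.

Lemma frank_wolfe_in {R : realType} {n : nat} {C : set 'rV[R]_n}
    {f : 'rV[R]_n -> R} {eta : nat -> R} {x : nat -> 'rV[R]_n} :
  @convex_set R 'rV[R]_n C -> (forall t, 0 <= eta t <= 1) ->
  frank_wolfe C f eta x -> forall t, C (x t).
Proof.
move=> cvxC eta01 [Cx0 fwx]; elim=> [//|t Cxt].
have [v [Cv _] ->] := fwx t; have /andP[e0 e1] := eta01 t.
have := cvxC v (x t) (Itv01 e0 e1) (mem_set Cv) (mem_set Cxt).
rewrite inE /conv /= /unstable.onem; congr C.
by rewrite scalerBl scale1r scalerBr addrCA.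
Qed.

(** A potential: its drop from [s] to [s + 1] is [1 / s - 1 / (s + l)] for [s >= 1], so the
    exponents accumulated by successive contractions telescope. *)
Definition recip_window {R : realType} (l s : nat) : R :=
  \sum_(j < l) (s + j)%:R^-1.

(** * Step sizes and the one-step contraction factor *)

Section StepSize.
Context {R : realType} {l : nat}.
Hypothesis l_ge1 : (1 <= l)%N.

Let l_gt0 : 0 < l%:R :> R. Proof. by rewrite ltr0n. Qed.

Lemma step0 : step R l 0 = 1.
Proof. by rewrite /step add0n divff// gt_eqF. Qed.

Lemma step_gt0 t : 0 < step R l t.
Proof. by rewrite divr_gt0// ltr0n addn_gt0 l_ge1 orbT. Qed.

Lemma step_le s t : (s <= t)%N -> step R l t <= step R l s.
Proof.
move=> st; rewrite ler_pM2l// lef_pV2 ?posrE ?ltr0n ?addn_gt0 ?l_ge1 ?orbT//.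
by rewrite ler_nat leq_add2r.
Qed.

Lemma step_le1 t : step R l t <= 1.
Proof. by rewrite -step0 step_le. Qed.

Lemma step_pred_le t : (1 <= t)%N -> step R l t.-1 <= l%:R / t%:R.
Proof.
case: t => // t _; rewrite ler_pM2l// lef_pV2 ?posrE ?ltr0n ?addn_gt0 ?l_ge1 ?orbT//.
by rewrite ler_nat /= -[t.+1]addn1 leq_add2l.
Qed.

Lemma recip_window_ge0 s : 0 <= recip_window l s :> R.
Proof. by apply: sumr_ge0 => j _; rewrite invr_ge0. Qed.

Lemma recip_window_le s : (1 <= s)%N -> recip_window l s <= l%:R / s%:R :> R.
Proof.
move=> s1; apply: (@le_trans _ _ (\sum_(j < l) s%:R^-1)).
  apply: ler_sum => j _; rewrite lef_pV2 ?posrE ?ltr0n ?addn_gt0 ?s1//.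
  by rewrite ler_nat leq_addr.
by rewrite sumr_const card_ord mulrC mulr_natr.
Qed.

Lemma recip_windowB s :
  recip_window l s - recip_window l s.+1 = s%:R^-1 - (s + l)%:R^-1 :> R.
Proof.
rewrite /recip_window -!(big_mkord xpredT (fun j => (_ + j)%:R^-1)).
under [X in _ - X]eq_bigr => j _ do rewrite addSnnS.
rewrite -sumrB.
under eq_bigr => j _ do rewrite -opprB.
by rewrite sumrN telescope_sumr// opprB addn0.
Qed.

(* Bernoulli gives [s / (s + l) <= (1 - 1 / (s + l)) ^ l]; an [eps]-fraction of
   the exponent is traded for [exp (- eps / (s + l))], and the remaining factor
   [1 + eps / s] of the left-hand side is at most [exp (eps / s)]. *)
Lemma step_contraction (eps : R) (s : nat) : 0 < eps < l%:R -> (1 <= s)%N ->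
  1 - step R l s * (1 - eps / l%:R) <=
  (step R l s / step R l s.-1) `^ (l%:R - eps)
  * expR (eps * (recip_window l s - recip_window l s.+1)).
Proof.
move=> /andP[eps0 epsl] s1.
have s0 : 0 < s%:R :> R by rewrite ltr0n.
have sl0 : 0 < (s + l)%:R :> R by rewrite ltr0n addn_gt0 s1.
have sl1 : 1 < (s + l)%:R :> R.
  by rewrite ltr1n -addn1 leq_add.
set u : R := (s + l)%:R^-1.
have u0 : 0 < u by rewrite invr_gt0.
have u1 : u < 1 by rewrite invf_lt1.
have -> : step R l s / step R l s.-1 = 1 - u.
  rewrite /step /u; case: s s1 s0 sl0 sl1 @u u0 u1 => // s _ _ sl0 _ _ _ _ /=.
  have sl0' : (s + l)%:R != 0 :> R by rewrite pnatr_eq0 addn_eq0 negb_and -!lt0n l_ge1 orbT.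
  rewrite addSn -natr1 in sl0 *; field.
  by rewrite -natrD sl0' !gt_eqF.
have -> : 1 - step R l s * (1 - eps / l%:R) = (1 - l%:R * u) * (1 + eps / s%:R).
  by rewrite /step /u natrD in sl0 *; field; rewrite !gt_eqF.
have bern : 1 - l%:R * u <= (1 - u) ^+ l by apply: bernoulli_subr; rewrite !ltW.
have q0 : 0 <= 1 - u by lra.
have qE : (1 - u) ^+ l = (1 - u) `^ (l%:R - eps) * (1 - u) `^ eps.
  rewrite -powRD ?subrK ?powR_mulrn//.
  by apply/implyP => _; rewrite gt_eqF// subr_gt0.
have qeps : (1 - u) `^ eps <= expR (- u * eps).
  rewrite expRM; apply: ge0_ler_powR; rewrite ?nnegrE ?expR_ge0 ?(ltW eps0)//.
  exact: expR_ge1Dx.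
have eps1 : 1 + eps / s%:R <= expR (eps / s%:R) by exact: expR_ge1Dx.
(* The exponents [- eps / (s + l)] and [eps / s] add up to [eps] times the drop of the potential. *)
rewrite recip_windowB -/u (_ : eps * (_ - u) = - u * eps + eps / s%:R); last by ring.
rewrite expRD mulrA; apply: ler_pM => //.
- by rewrite subr_ge0 /u ler_pdivrMr// mul1r ler_nat leq_addl.
- by rewrite addr_ge0// divr_ge0// ltW.
by rewrite (le_trans bern)// qE ler_wpM2l ?powR_ge0.
Qed.

End StepSize.

(** * The scalar recurrence for suboptimalities [h] and gaps [g] *)

Section Recurrence.
Context {R : realType} {l : nat} {M r eps : R} {h g : nat -> R}.
Hypotheses (l_ge1 : (1 <= l)%N) (M_gt0 : 0 < M) (r_itv : 0 <= r < 1).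
Hypothesis eps_itv : 0 < eps < l%:R.
Hypothesis hg : forall t, 0 <= h t <= g t.
Hypothesis h_strong : forall t,
  h t.+1 <= h t - step R l t * g t + M * step R l t ^+ 2 / 2.
Hypothesis h_weak : forall t,
  (h t.+1 - (h t - step R l t * g t)) * h t `^ (1 - r)
  <= M * step R l t ^+ 2 / 2 * g t.

(** The value of [h] solving [M * eta ^ 2 / 2 = eta * (eps / l) * h ^ (1 - r)] with
    [eta = step R l t]. *)
Let threshold t := (step R l t * l%:R * M / (2 * eps)) `^ (1 - r)^-1.
Let ratio s t := step R l t.-1 / step R l s.-1.
Let expo := Num.min (l%:R - eps) (Num.min (1 - r)^-1 2).

Let l_gt0 : 0 < l%:R :> R. Proof. by rewrite ltr0n. Qed.
Let eps_gt0 : 0 < eps. Proof. by case/andP: eps_itv. Qed.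
Let leps_ge0 : 0 <= l%:R - eps.
Proof. by case/andP: eps_itv => _ /ltW; rewrite subr_ge0. Qed.
Let r1_gt0 : 0 < 1 - r. Proof. by case/andP: r_itv => _; rewrite subr_gt0. Qed.

Let threshold_base_gt0 t : 0 < step R l t * l%:R * M / (2 * eps).
Proof.
apply: divr_gt0; last exact: mulr_gt0.
by apply: mulr_gt0 => //; apply: mulr_gt0 => //; exact: step_gt0.
Qed.

Lemma contraction_above_threshold t : (1 <= t)%N -> threshold t < h t ->
  h t.+1 <= h t * (ratio t t.+1 `^ (l%:R - eps)
                   * expR (eps * (recip_window l t - recip_window l t.+1))).
Proof.
move=> t1 ht; have /andP[h0 hleg] := hg t.
have s0 := step_gt0 l_ge1 t : 0 < step R l t.
set q := step R l t * l%:R * M / (2 * eps).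
have qp : q < h t `^ (1 - r).
  have -> : q = threshold t `^ (1 - r).
    by rewrite -powRrM mulVf ?gt_eqF// powRr1// ltW// threshold_base_gt0.
  by rewrite gt0_ltr_powR ?nnegrE ?powR_ge0.
have q0 : 0 < q := threshold_base_gt0 t.
have p0 : 0 < h t `^ (1 - r) := lt_trans q0 qp.
(* The right-hand side of weak growth equals [eta * g * (eps / l) * q]; since [q] is below
   [h ^ (1 - r)], that power cancels. *)
have D : h t.+1 - (h t - step R l t * g t) <= step R l t * g t * (eps / l%:R).
  rewrite -(ler_pM2r p0); apply: le_trans (h_weak t) _.
  have -> : M * step R l t ^+ 2 / 2 * g t = step R l t * g t * (eps / l%:R) * q.
    by rewrite /q; field; rewrite !gt_eqF.
  apply: ler_wpM2l (ltW qp).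
  by rewrite !mulr_ge0 ?invr_ge0 ?(le_trans h0 hleg) ?(ltW s0) ?(ltW eps_gt0).
apply: le_trans (ler_wpM2l h0 (step_contraction l_ge1 eps t eps_itv t1)).
(* The progress left is [eta * (1 - eps / l) * g]; as [eps < l], replacing [g] by the smaller [h]
   only weakens it. *)
have : step R l t * (1 - eps / l%:R) * h t <= step R l t * (1 - eps / l%:R) * g t.
  rewrite ler_wpM2l// mulr_ge0 ?(ltW s0)// subr_ge0 ler_pdivrMr// mul1r.
  by rewrite -subr_ge0.
move: D; set e := eps / _; lra.
Qed.

Lemma ratio_itv s t : (s <= t)%N -> 0 < ratio s t <= 1.
Proof.
move=> st; rewrite divr_gt0 ?step_gt0//= ler_pdivrMr ?step_gt0// mul1r.
by rewrite step_le// -!subn1 leq_sub2r.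
Qed.

Lemma decay_above_threshold N : (1 <= N)%N ->
  (forall t, (N <= t)%N -> threshold t < h t) ->
  forall t, (N <= t)%N ->
    h t <= h N * ratio N t `^ (l%:R - eps) * expR (eps * l%:R / N%:R).
Proof.
move=> N1 above t Nt.
(* The induction carries the exact drop of the potential, which telescopes; only afterwards is it
   relaxed to [l / N]. *)
suff : h t <= h N * ratio N t `^ (l%:R - eps)
              * expR (eps * (recip_window l N - recip_window l t)).
  move/le_trans; apply; apply: ler_wpM2l.
    by rewrite mulr_ge0 ?powR_ge0//; case/andP: (hg N).
  rewrite ler_expR -mulrA ler_pM2l//.
  by rewrite (le_trans _ (recip_window_le N N1))// gerBl recip_window_ge0.
elim: t Nt => [|t IHt]; first by rewrite leqn0 => /eqP N0; rewrite N0 in N1.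
rewrite leq_eqVlt => /predU1P[->|Nt].
  by rewrite subrr mulr0 expR0 mulr1 /ratio divff ?gt_eqF ?step_gt0// powR1 mulr1.
have t1 : (1 <= t)%N := leq_trans N1 Nt.
apply: le_trans (contraction_above_threshold t t1 (above t Nt)) _.
apply: le_trans (ler_wpM2r _ (IHt Nt)) _.
  by rewrite mulr_ge0 ?powR_ge0 ?expR_ge0.
have -> : ratio N t.+1 = ratio N t * ratio t t.+1.
  by rewrite /ratio [RHS]mulrC [RHS]mulrA divfK// gt_eqF// step_gt0.
have /andP[a0 _] := ratio_itv N t Nt.
have /andP[b0 _] := ratio_itv t t.+1 (leqnSn t).
rewrite (powRM _ (ltW a0) (ltW b0)).
rewrite (_ : eps * (recip_window l N - recip_window l t.+1) =
  eps * (recip_window l N - recip_window l t)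
  + eps * (recip_window l t - recip_window l t.+1)); last by ring.
by rewrite expRD le_eqVlt; apply/orP; left; apply/eqP; ring.
Qed.

(** The maximum in [fw_bound] without the factor [expR (eps * l)], which the induction builds up
    gradually. *)
Let fw_max t := Num.max (step R l t.-1 `^ (l%:R - eps) * (M / 2))
  (step R l t.-1 `^ expo * ((l%:R * M / (2 * eps)) `^ (1 - r)^-1 + M / 2)).

Let coef_ge0 : 0 <= (l%:R * M / (2 * eps)) `^ (1 - r)^-1 + M / 2.
Proof. by rewrite addr_ge0 ?powR_ge0// divr_ge0// ltW. Qed.

(** Both branches are powers of the step size with exponent at most [l - eps], and the ratio is at
    most 1, so its power [l - eps] shrinks each branch at least as much as the next step size
    does. *)
Lemma fw_max_step t : ratio t t.+1 `^ (l%:R - eps) * fw_max t <= fw_max t.+1.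
Proof.
have r01 := ratio_itv t t.+1 (leqnSn t); have /andP[r0 _] := r01.
have rM p : ratio t t.+1 `^ p * step R l t.-1 `^ p = step R l t `^ p.
  by rewrite -powRM ?(ltW r0) ?(ltW (step_gt0 _ _))// divfK// gt_eqF// step_gt0.
rewrite /fw_max maxr_pMr ?powR_ge0// ge_max !le_max [X in X <= _]mulrA rM lexx /=.
apply/orP; right; rewrite [leLHS]mulrA ler_wpM2r// -[leRHS]rM.
rewrite ler_wpM2r ?powR_ge0//.
by apply: ger_powR r01 _ _ _; rewrite ge_min lexx.
Qed.

(** Strong growth leaves at most the threshold plus [M * eta ^ 2 / 2]. As [eta <= 1], lowering the
    exponents [1 / (1 - r)] and [2] to [expo] only increases both terms, giving the second branch of
    the maximum. *)
Lemma below_threshold_step t : h t <= threshold t -> h t.+1 <= fw_max t.+1.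
Proof.
move=> ht; have /andP[h0 hleg] := hg t.
have s0 := step_gt0 l_ge1 t : 0 < step R l t.
have s01 : 0 < step R l t <= 1 by rewrite s0 step_le1.
rewrite le_max; apply/orP; right => /=.
have hS : h t.+1 <= threshold t + step R l t `^ 2 * (M / 2).
  apply: le_trans (h_strong t) _; rewrite powR_mulrn ?(ltW s0)//.
  have : 0 <= step R l t * g t by rewrite mulr_ge0 ?(ltW s0)// (le_trans h0).
  by lra.
apply: le_trans hS _; rewrite mulrDr; apply: lerD.
  have c0 : 0 <= l%:R * M / (2 * eps) by rewrite divr_ge0 ?mulr_ge0// ltW.
  rewrite /threshold (_ : _ / _ = step R l t * (l%:R * M / (2 * eps))); last first.
    by rewrite !mulrA.
  rewrite powRM ?(ltW s0)//.
  rewrite ler_wpM2r ?powR_ge0//; apply: ger_powR s01 _ _ _.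
  by rewrite /expo !ge_min lexx orbT.
rewrite ler_wpM2r ?divr_ge0 ?(ltW M_gt0)//; apply: ger_powR s01 _ _ _.
by rewrite /expo !ge_min lexx !orbT.
Qed.

Lemma recurrence_bound t : (1 <= t)%N -> h t <= fw_bound l M r eps t.
Proof.
move=> t1.
have fw_max_ge0 s : 0 <= fw_max s.
  by rewrite le_max mulr_ge0 ?powR_ge0// divr_ge0// ltW.
have relax s : (1 <= s)%N -> h s <= fw_max s ->
    h s <= expR (eps * (l%:R - recip_window l s)) * fw_max s.
  move=> s1 /le_trans; apply; rewrite ler_peMl// -[leLHS]expR0 ler_expR.
  rewrite mulr_ge0 ?(ltW eps_gt0)// subr_ge0.
  rewrite (le_trans (recip_window_le s s1))// ler_pdivrMr ?ltr0n//.
  by rewrite ler_peMr ?(ltW l_gt0)// ler1n.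
(* The exponential factor is at least 1 because the potential is at most [l], grows exactly as a
   contraction step requires, and never exceeds [expR (eps * l)]. *)
suff : h t <= expR (eps * (l%:R - recip_window l t)) * fw_max t.
  move/le_trans; apply; rewrite ler_wpM2r// ler_expR ler_pM2l//.
  by rewrite gerBl recip_window_ge0.
elim: t t1 => [//|t IHt] _; case: t IHt => [_|t IHt].
  apply: relax => //; rewrite le_max /= step0// powR1 mul1r.
  (* The first step has size 1, so [h 1 <= h 0 - g 0 + M / 2 <= M / 2], whatever the starting
     point. *)
  apply/orP; left; apply: le_trans (h_strong 0) _.
  have := hg 0; rewrite step0// => /andP[_]; rewrite expr1n mul1r mulr1.
  by lra.
have [below|above] := leP (h t.+1) (threshold t.+1).
  exact/relax/below_threshold_step.
apply: le_trans (contraction_above_threshold t.+1 isT above) _.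
set k := _ * expR _.
have k0 : 0 <= k by rewrite mulr_ge0 ?powR_ge0 ?expR_ge0.
apply: le_trans (ler_wpM2r k0 (IHt isT)) _.
apply: le_trans (ler_wpM2l (expR_ge0 _) (fw_max_step t.+1)).
rewrite /k (_ : eps * (l%:R - recip_window l t.+2) =
  eps * (l%:R - recip_window l t.+1)
  + eps * (recip_window l t.+1 - recip_window l t.+2)); last by ring.
by rewrite expRD le_eqVlt; apply/orP; left; apply/eqP; ring.
Qed.

Lemma fw_bound_bigO : (fw_bound l M r eps : nat -> R) =O_\oo
  (fun t : nat => t%:R `^ (- l%:R + eps) + t%:R `^ (- (1 - r)^-1)
                  + t%:R `^ (- 2)).
Proof.
(* Bounding the maximum by a sum and the step size at [t - 1] by [l / t] gives this constant. *)
pose K := expR (eps * l%:R) * (l%:R `^ (l%:R - eps) * (M / 2)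
  + l%:R `^ expo * ((l%:R * M / (2 * eps)) `^ (1 - r)^-1 + M / 2)).
have expo_ge0 : 0 <= expo by rewrite !le_min leps_ge0 invr_ge0 (ltW r1_gt0) /=.
have K0 : 0 < K.
  rewrite mulr_gt0 ?expR_gt0// ltr_pwDl ?mulr_gt0 ?powR_gt0 ?divr_gt0//.
  by rewrite mulr_ge0 ?powR_ge0.
apply/eqO_exP; exists K => //; near=> t.
have t1 : (1 <= t)%N by near: t; exact: nbhs_infty_ge.
have t0 : 0 < t%:R :> R by rewrite ltr0n.
have sp p : 0 <= p -> step R l t.-1 `^ p <= l%:R `^ p * t%:R `^ (- p).
  move=> p0; rewrite -(mulN1r p) powRrM powR_inv1// -powRM ?ler0n ?invr_ge0//.
  by rewrite ge0_ler_powR ?nnegrE ?(ltW (step_gt0 _ _))// ?divr_ge0// step_pred_le.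
set T : R := _ + t%:R `^ (- 2).
have T1 : t%:R `^ (- (l%:R - eps)) <= T.
  by rewrite opprB addrC /T -addrA lerDl addr_ge0 ?powR_ge0.
(* The minimum [expo] is one of three exponents, each matching one summand of [T]. *)
have T2 : t%:R `^ (- expo) <= T.
  rewrite /expo /Num.min; case: ifP => _ //; case: ifP => _.
    by rewrite /T addrAC lerDr addr_ge0 ?powR_ge0.
  by rewrite /T lerDr addr_ge0 ?powR_ge0.
have T0 : 0 <= T := le_trans (powR_ge0 _ _) T2.
have fw0 : 0 <= fw_max t.
  by rewrite le_max mulr_ge0 ?powR_ge0// divr_ge0// ltW.
rewrite (ger0_norm T0) ger0_norm ?mulr_ge0 ?expR_ge0//.
rewrite /K -[leRHS]mulrA ler_wpM2l ?expR_ge0//.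
have M2 : 0 <= M / 2 by rewrite divr_ge0// ltW.
have A1 : step R l t.-1 `^ (l%:R - eps) * (M / 2)
    <= l%:R `^ (l%:R - eps) * (M / 2) * T.
  rewrite mulrAC ler_wpM2r// (le_trans (sp _ leps_ge0))//.
  by rewrite ler_wpM2l// powR_ge0.
have c_ge0 := coef_ge0; set c := (_ `^ _ + M / 2) in c_ge0 *.
have A2 : step R l t.-1 `^ expo * c <= l%:R `^ expo * c * T.
  rewrite mulrAC ler_wpM2r// (le_trans (sp _ expo_ge0))//.
  by rewrite ler_wpM2l// powR_ge0.
rewrite mulrDl ge_max (le_trans A1) ?(le_trans A2)//.
  by rewrite lerDr mulr_ge0// mulr_ge0// powR_ge0.
by rewrite lerDl mulr_ge0// mulr_ge0// powR_ge0.
Unshelve. all: by end_near. Qed.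

End Recurrence.

(** * The recurrence applied to the Frank-Wolfe iterates *)

Theorem theorem4p1 (R : realType) (n : nat) (C : set 'rV[R]_n)
    (f : 'rV[R]_n -> R) (U : set 'rV[R]_n) (l : nat) (M r eps : R)
    (x : nat -> 'rV[R]_n)
    (cptC : compact C) (cvxC : @convex_set R 'rV[R]_n C)
    (cvxf : @convex_function R 'rV[R]_n C f)
    (openU : open U) (CU : C `<=` U)
    (diff_f : forall y, U y -> differentiable f y)
    (l_ge1 : (1 <= l)%N) (M_gt0 : 0 < M) (r_itv : 0 <= r < 1)
    (strongf : strong_growth0 C f M) (weakf : weak_growth C f M r)
    (eps_itv : 0 < eps < l%:R)
    (fwx : frank_wolfe C f (step R l) x) :
  [/\ forall t : nat, (1 <= t)%N -> subopt C f (x t) <= fw_bound l M r eps t,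
      (fw_bound l M r eps : nat -> R) =O_\oo
        (fun t : nat => t%:R `^ (- l%:R + eps) + t%:R `^ (- (1 - r)^-1)
                        + t%:R `^ (- 2))
    & (exists tau : nat -> nat,
         {homo tau : i j / (i < j)%N} /\
         forall i : nat, subopt C f (x (tau i))
           <= (step R l (tau i) * l%:R * M / (2 * eps)) `^ (1 - r)^-1)
      \/
      (exists N : nat, (1 <= N)%N /\
         forall t : nat, (N.+1 <= t)%N ->
           subopt C f (x t)
             <= subopt C f (x N)
                * (step R l t.-1 / step R l N.-1) `^ (l%:R - eps)
                * expR (eps * l%:R / N%:R)) ].
Proof.
have s01 t : 0 <= step R l t <= 1 by rewrite ltW ?step_gt0 ?step_le1.
have Cx := frank_wolfe_in cvxC s01 fwx.
have df t : differentiable f (x t) by exact/diff_f/CU/Cx.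
have [_ fw_step] := fwx.
pose g t := fw_gap C f (x t).
have hg t : 0 <= subopt C f (x t) <= g t.
  by have [v argv _] := fw_step t; exact: (subopt_le_fw_gap argv (Cx t)).
have h_strong t : subopt C f (x t.+1) <=
    subopt C f (x t) - step R l t * g t + M * step R l t ^+ 2 / 2.
  have [v argv ->] := fw_step t; rewrite (subopt_step argv) lerD2l.
  exact: strongf.
have h_weak t :
    (subopt C f (x t.+1) - (subopt C f (x t) - step R l t * g t))
    * subopt C f (x t) `^ (1 - r) <= M * step R l t ^+ 2 / 2 * g t.
  have [v argv ->] := fw_step t; rewrite (subopt_step argv) addrAC subrr add0r.
  exact: weakf.
split.
- exact: (recurrence_bound l_ge1 M_gt0 r_itv eps_itv hg h_strong h_weak).
- exact: (fw_bound_bigO l_ge1 M_gt0 r_itv eps_itv).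
(* Either indices at or below the threshold are unbounded and yield the subsequence, or all late
   iterates lie above it. *)
have [often|] := pselect (forall N, exists2 t, (N <= t)%N & subopt C f (x t)
    <= (step R l t * l%:R * M / (2 * eps)) `^ (1 - r)^-1).
  by left; exact: (ltn_subsequence _ often).
(* The index [N] may be 0, so [N.+1] serves as the starting index, which must be at least 1. *)
move=> /existsNP[N rare]; right; exists N.+1; split => // t Nt.
have rareN s : (N.+1 <= s)%N ->
    (step R l s * l%:R * M / (2 * eps)) `^ (1 - r)^-1 < subopt C f (x s).
  move=> Ns; rewrite ltNge; apply/negP => hs; apply: rare; exists s => //.
  exact: ltnW.
have := decay_above_threshold l_ge1 M_gt0 r_itv eps_itv hg h_weak N.+1 isT rareN t.
by apply; exact: ltnW.
Qed.
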